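(* $$\sum_{k=0}^\infty \frac{H_{2k}-H_k}{(3k+1)\binom{3k}{k}}\,\frac{(-1)^k k}{4^{k+1}} = \frac{3}{448}\ln 2-\frac{9}{512}\ln^2 2-\frac{3}{128}\arctan^2\left(\frac{\sqrt7}{5}\right)-\left(\frac{1}{224}-\frac{89}{6272}\ln 2\right)\sqrt7\,\arctan\left(\frac{\sqrt7}{5}\right).$$
   Context: $H_n=\sum_{k=1}^n \frac1k$ with $H_0=0$; $\ln^2 2=(\ln 2)^2$ and $\arctan^2(t)=(\arctan t)^2$. *)

(* Defs.v *)
From Stdlib Require Import Reals.
From Coquelicot Require Import Coquelicot.

Local Open Scope R_scope.

(* sum_n_m is 0 when the upper bound is below the lower one, so harmonic 0 = 0. *)
Definition harmonic (n : nat) : R := sum_n_m (fun k => 1 / INR k) 1 n.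

(* Main.v *)
(* Since 1/((3k+1) C(3k,k)) is the Beta integral of x^(2k) (1-x)^k over [0,1], and H_(2k) - H_k is
   the logarithmic derivative of B(2k+1+s, k+1-s) at s = 0, the k-th term is the integral of
   x^(2k) (1-x)^k ln(x/(1-x)) times (-1)^k k/4^(k+1). Summing the geometric-type series, the sum
   is
     - int_0^1 x^2 (1-x) ln(x/(1-x)) / ((2-x)^2 (x^2+x+2)^2) dx.
   After partial fractions all that is not elementary comes from
     int_0^oo ln u (1/(u+a) - 1/(u+1)) du = - Log(a)^2 / 2,   u = x/(1-x),
   for a = 2 and a = (5 + i sqrt 7)/8, which is proved by differentiating in a, first along the
   real axis and then along a vertical segment. All integrands are multiplied out so as to contain
   the weight x (1-x) ln(x/(1-x)), continuous on [0,1], so that every integral is proper. *)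
Require Import Defs.
From Stdlib Require Import Reals Factorial Lra Lia.
From Coquelicot Require Import Coquelicot.

Local Open Scope R_scope.

(** * Bounds and continuity of x ln x up to the end point 0 *)

Lemma ln_le_sub_1 (x : R) : 0 < x -> ln x <= x - 1.
Proof.
  intros Hx. pose proof (exp_ineq1_le (ln x)) as H. rewrite exp_ln in H by assumption; lra.
Qed.

Lemma ln_nonpos (x : R) : x <= 0 -> ln x = 0.
Proof. intros Hx. unfold ln. destruct (Rlt_dec 0 x); [exfalso; lra | reflexivity]. Qed.

(** The inequality ln t <= t - 1 at t = 1/x gives - x ln x <= 1 - x. *)
Lemma Rabs_xlnx_le_1 (x : R) : 0 <= x <= 1 -> Rabs (x * ln x) <= 1.
Proof.
  intros [[H0 | <-] H1].
  - assert (Hi : 0 < / x) by now apply Rinv_0_lt_compat.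
    pose proof (ln_le_sub_1 (/ x) Hi) as Hl. rewrite ln_Rinv in Hl by assumption.
    pose proof (ln_le_sub_1 x H0). assert (x * / x = 1) by (field; lra).
    apply Rabs_le; split; nra.
  - rewrite Rmult_0_l, Rabs_R0; lra.
Qed.

(** Writing x ln x = 2 sqrt x (sqrt x ln (sqrt x)) and bounding the bracket by 1 yields an estimate
    that tends to 0 with x. *)
Lemma Rabs_xlnx_le_sqrt (x : R) : 0 < x <= 1 -> Rabs (x * ln x) <= 2 * sqrt x.
Proof.
  intros [H0 H1]. pose proof (sqrt_lt_R0 x H0) as Hs.
  assert (Hq : sqrt x * sqrt x = x) by (apply sqrt_sqrt; lra).
  pose proof (Rabs_xlnx_le_1 (sqrt x)) as H.
  assert (Hs1 : sqrt x <= 1) by nra.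
  specialize (H (conj (Rlt_le _ _ Hs) Hs1)).
  replace (x * ln x) with (2 * sqrt x * (sqrt x * ln (sqrt x))).
  - rewrite Rabs_mult, (Rabs_right (2 * sqrt x)) by lra. nra.
  - replace (ln x) with (ln (sqrt x * sqrt x)) by now rewrite Hq.
    rewrite ln_mult by assumption.
    apply (f_equal (fun t => t * (2 * ln (sqrt x)))) in Hq. lra.
Qed.

(** At 0 the limit is two-sided: [ln] takes the value 0 at nonpositive arguments, so the product is
    0 on the left, and the bound by 2 sqrt x controls the right. *)
Lemma continuous_xlnx (x : R) : 0 <= x -> continuous (fun t => t * ln t) x.
Proof.
  intros [Hx | <-].
  - apply (ex_derive_continuous (V := R_NormedModule)). now auto_derive.
  - apply continuity_pt_filterlim. intros eps Heps.
    exists (Rmin 1 ((eps / 4) ^ 2)). split.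
    + apply Rmin_pos; [lra | apply pow_lt; lra].
    + intros y [_ Hy]. unfold dist in *; simpl in *. unfold R_dist in *.
      rewrite Rminus_0_r in Hy. rewrite Rmult_0_l, Rminus_0_r.
      destruct (Rle_lt_dec y 0) as [Hn | Hp].
      * rewrite ln_nonpos, Rmult_0_r, Rabs_R0 by assumption. lra.
      * rewrite (Rabs_right y) in Hy by lra.
        pose proof (Rmin_l 1 (eps / 4 * (eps / 4 * 1))).
        pose proof (Rmin_r 1 (eps / 4 * (eps / 4 * 1))).
        apply Rle_lt_trans with (2 * sqrt y); [apply Rabs_xlnx_le_sqrt; lra |].
        assert (sqrt y < eps / 4); [| lra].
        rewrite <- (sqrt_square (eps / 4)) by lra. apply sqrt_lt_1; nra.
Qed.

Lemma continuous_xlnx_sym (x : R) : x <= 1 -> continuous (fun t => (1 - t) * ln (1 - t)) x.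
Proof.
  intros Hx. apply (continuous_comp (fun t => 1 - t) (fun t => t * ln t)).
  - apply (ex_derive_continuous (V := R_NormedModule)). now auto_derive.
  - apply continuous_xlnx; lra.
Qed.

(** * Integrals from primitives with logarithmic end-point behaviour *)

Lemma is_RInt_congr (f g : R -> R) (a b u v : R) :
  a <= b -> is_RInt f a b u -> (forall x, a < x < b -> f x = g x) -> u = v -> is_RInt g a b v.
Proof.
  intros Hab Hf Hfg <-. revert Hf. apply is_RInt_ext.
  now rewrite Rmin_left, Rmax_right.
Qed.

Lemma is_RInt_zero (g : R -> R) (a b v : R) :
  a <= b -> (forall x, a < x < b -> g x = 0) -> v = 0 -> is_RInt g a b v.
Proof.
  intros Hab Hg ->. apply is_RInt_congr with (fun _ => 0) (scal (b - a) 0).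
  - assumption.
  - apply (is_RInt_const (V := R_NormedModule)).
  - intros x Hx. now rewrite Hg.
  - unfold scal; simpl; unfold mult; simpl; ring.
Qed.

(** Projection of the line onto [a,b]: composing with it extends a function continuous on [a,b] to
    one continuous everywhere. *)
Definition clamp (a b x : R) : R := Rmax a (Rmin b x).

Lemma clamp_id (a b x : R) : a <= x <= b -> clamp a b x = x.
Proof. intros Hx. unfold clamp. rewrite Rmin_right, Rmax_right; lra. Qed.

Lemma clamp_bounds (a b x : R) : a <= b -> a <= clamp a b x <= b.
Proof. intros Hab. unfold clamp, Rmax, Rmin. repeat destruct (Rle_dec _ _); lra. Qed.

Lemma continuous_clamp (a b x : R) : a <= b -> continuous (clamp a b) x.
Proof.
  intros Hab. apply continuity_pt_filterlim. intros eps Heps. exists eps. split; [assumption |].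
  intros y [_ Hy]. unfold dist in *; simpl in *. unfold R_dist in *.
  apply Rle_lt_trans with (2 := Hy). unfold clamp, Rmax, Rmin, Rabs.
  repeat (destruct (Rle_dec _ _) || destruct (Rcase_abs _)); lra.
Qed.

(* The primitive [G] need only be differentiable in the interior, which admits the logarithmic
   end-point singularities below. *)
Lemma is_RInt_derive_open (f G : R -> R) (a b : R) :
  a < b ->
  (forall x, a <= x <= b -> continuous f x) ->
  (forall x, a <= x <= b -> continuous G x) ->
  (forall x, a < x < b -> is_derive G x (f x)) ->
  is_RInt f a b (G b - G a).
Proof.
  intros Hab Hf HG Hd.
  (* The extension [g] is continuous on the whole line, so its integral is differentiable at every
     point, a and b included. *)
  pose (g := fun x => f (clamp a b x)).
  assert (Hg : forall x, continuous g x).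
  { intros x. apply (continuous_comp (clamp a b) f).
    - apply continuous_clamp; lra.
    - apply Hf, clamp_bounds; lra. }
  assert (Hgf : forall x, a <= x <= b -> g x = f x)
    by (intros x Hx; unfold g; now rewrite clamp_id).
  assert (HIg : forall c, ex_RInt g a c)
    by (intros c; apply (ex_RInt_continuous (V := R_CompleteNormedModule)); intros; apply Hg).
  assert (HP : forall x, is_derive (fun x => RInt g a x) x (g x)).
  { intros x. apply (is_derive_RInt g _ a); [| apply Hg].
    apply filter_forall. intros y. apply (RInt_correct (V := R_CompleteNormedModule)), HIg. }
  (* The difference is continuous on [a,b] with derivative 0 inside, so it takes the same value at
     both ends. *)
  destruct (MVT_gen (fun x => RInt g a x - G x) a b (fun _ => 0)) as [c [_ Hc]].
  - rewrite Rmin_left, Rmax_right by lra. intros x Hx.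
    replace 0 with (minus (g x) (f x)).
    + apply (is_derive_minus (K := R_AbsRing) (V := R_NormedModule)); [apply HP | now apply Hd].
    + rewrite Hgf by lra. unfold minus, plus, opp; simpl; lra.
  - rewrite Rmin_left, Rmax_right by lra. intros x Hx. apply continuity_pt_filterlim.
    apply (continuous_minus (V := R_NormedModule) (fun x => RInt g a x)); [| now apply HG].
    apply (ex_derive_continuous (V := R_NormedModule)). eexists; apply HP.
  - replace (G b - G a) with (RInt g a b).
    + apply is_RInt_ext with g.
      * rewrite Rmin_left, Rmax_right by lra. intros; apply Hgf; lra.
      * apply (RInt_correct (V := R_CompleteNormedModule)), HIg.
    + assert (RInt g a a = 0) by apply (RInt_point (V := R_CompleteNormedModule)). lra.
Qed.

(** Both t ln t and (1-t) ln (1-t) vanish at 0 and at 1, so only [C] contributes boundary terms. *)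
Lemma is_RInt_log (A B C f : R -> R) :
  (forall x, 0 <= x <= 1 -> ex_derive A x) ->
  (forall x, 0 <= x <= 1 -> ex_derive B x) ->
  (forall x, 0 <= x <= 1 -> ex_derive C x) ->
  (forall x, 0 <= x <= 1 -> continuous f x) ->
  (forall x, 0 < x < 1 ->
     is_derive (fun t => A t * (t * ln t) + B t * ((1 - t) * ln (1 - t)) + C t) x (f x)) ->
  is_RInt f 0 1 (C 1 - C 0).
Proof.
  intros HA HB HC Hf Hd.
  pose (G := fun t => A t * (t * ln t) + B t * ((1 - t) * ln (1 - t)) + C t).
  replace (C 1 - C 0) with (G 1 - G 0).
  - apply is_RInt_derive_open; [lra | assumption | | assumption].
    assert (He : forall h x, ex_derive h x -> continuous h x)
      by (intros; now apply (ex_derive_continuous (V := R_NormedModule))).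
    intros x Hx. apply (continuous_plus (V := R_NormedModule)); [| now apply He, HC].
    apply (continuous_plus (V := R_NormedModule)).
    + apply (continuous_mult A); [now apply He, HA | apply continuous_xlnx; lra].
    + apply (continuous_mult B); [now apply He, HB | apply continuous_xlnx_sym; lra].
  - unfold G. replace (1 - 1) with 0 by ring. rewrite Rminus_0_r, ln_1. ring.
Qed.

(** * The weight x (1-x) ln(x/(1-x)) *)

Definition logw (x : R) : R := x * (1 - x) * (ln x - ln (1 - x)).

Lemma continuous_logw (x : R) : 0 <= x <= 1 -> continuous logw x.
Proof.
  intros Hx.
  apply continuous_ext with (fun t => (1 - t) * (t * ln t) - t * ((1 - t) * ln (1 - t))).
  - intros t. unfold logw. apply Rminus_diag_uniq. ring.
  - assert (He : forall h x, ex_derive h x -> continuous h x)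
      by (intros; now apply (ex_derive_continuous (V := R_NormedModule))).
    apply (continuous_minus (V := R_NormedModule)).
    + apply (continuous_mult (fun t => 1 - t)); [apply He; now auto_derive | apply continuous_xlnx; lra].
    + apply (continuous_mult (fun t : R => t) (fun t : R => (1 - t) * ln (1 - t))); [apply He; now auto_derive | apply continuous_xlnx_sym; lra].
Qed.

(** The weight is the convex combination, with coefficients 1-x and x, of x ln x and -(1-x) ln
    (1-x), both bounded by 1. *)
Lemma Rabs_logw_le_1 (x : R) : 0 <= x <= 1 -> Rabs (logw x) <= 1.
Proof.
  intros Hx.
  replace (logw x) with ((1 - x) * (x * ln x) + x * - ((1 - x) * ln (1 - x)))
    by (unfold logw; ring).
  pose proof (Rabs_xlnx_le_1 x Hx) as H1.
  pose proof (Rabs_xlnx_le_1 (1 - x) ltac:(lra)) as H2.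
  apply Rabs_le_between in H1. apply Rabs_le_between in H2. apply Rabs_le. nra.
Qed.

Lemma logw_sym (x : R) : logw (1 - x) = - logw x.
Proof. unfold logw. replace (1 - (1 - x)) with x by ring. ring. Qed.

Lemma continuous_logw_mult (h : R -> R) (x : R) :
  0 <= x <= 1 -> ex_derive h x -> continuous (fun t => logw t * h t) x.
Proof.
  intros Hx Hh. apply (continuous_mult logw); [now apply continuous_logw |].
  now apply (ex_derive_continuous (V := R_NormedModule)).
Qed.

(** * From the series to a single integral *)

Section Series.

Local Arguments INR : simpl never.

Lemma harmonic_S (n : nat) : harmonic (S n) = harmonic n + 1 / INR (S n).
Proof. unfold harmonic. rewrite sum_n_Sm by lia. reflexivity. Qed.

Lemma INR_fact_S (n : nat) : INR (fact (S n)) = (INR n + 1) * INR (fact n).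
Proof. now rewrite fact_simpl, mult_INR, S_INR. Qed.

(** Induction on m for all n: the derivative of x^(m+1) (1-x)^(n+1) integrates to 0, which expresses
    the integral with exponents m+1, n through the one with exponents m, n+1. *)
Lemma is_RInt_beta (m n : nat) :
  is_RInt (fun x => x ^ m * (1 - x) ^ n) 0 1
    (INR (fact m) * INR (fact n) / INR (fact (m + n + 1))).
Proof.
  revert n. induction m as [|m IH]; intros n.
  - replace (INR (fact 0) * INR (fact n) / INR (fact (0 + n + 1)))
      with (minus (- (1 - 1) ^ S n / (INR n + 1)) (- (1 - 0) ^ S n / (INR n + 1))).
    + apply (is_RInt_derive (fun x => - (1 - x) ^ S n / (INR n + 1))).
      * intros x _. pose proof (pos_INR n). auto_derive; [lra |].
        rewrite S_INR. simpl. unfold Rminus. field. lra.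
      * intros x _. apply (ex_derive_continuous (V := R_NormedModule)). now auto_derive.
    + replace (0 + n + 1)%nat with (S n) by lia. rewrite INR_fact_S.
      pose proof (pos_INR n). pose proof (INR_fact_neq_0 n).
      replace (1 - 1) with 0 by ring. rewrite pow_ne_zero by lia.
      rewrite Rminus_0_r, pow1. change (INR (fact 0)) with 1.
      unfold minus, plus, opp; simpl. field. split; [assumption | lra].
  - pose proof (pos_INR n). pose proof (pos_INR m).
    assert (Hd : is_RInt (fun x => (INR m + 1) * (x ^ m * (1 - x) ^ S n)
        - (INR n + 1) * (x ^ S m * (1 - x) ^ n)) 0 1 0).
    { replace 0 with (minus (1 ^ S m * (1 - 1) ^ S n) (0 ^ S m * (1 - 0) ^ S n)) at 2
        by (unfold minus, plus, opp; simpl; ring).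
      apply (is_RInt_derive (fun x => x ^ S m * (1 - x) ^ S n)).
      - intros x _. auto_derive; [trivial |]. rewrite !S_INR. simpl. unfold Rminus. ring.
      - intros x _. apply (ex_derive_continuous (V := R_NormedModule)). now auto_derive. }
    specialize (IH (S n)).
    pose proof (is_RInt_minus _ _ _ _ _ _ (is_RInt_scal _ _ _ (INR m + 1) _ IH) Hd) as Hm.
    apply (is_RInt_scal _ _ _ (/ (INR n + 1))) in Hm.
    apply (is_RInt_congr _ _ _ _ _ _ Rle_0_1 Hm).
    + intros x _. unfold scal, minus, plus, opp; simpl; unfold mult; simpl. field. lra.
    + replace (m + S n + 1)%nat with (S m + n + 1)%nat by lia. rewrite !INR_fact_S.
      pose proof (INR_fact_neq_0 (S m + n + 1)).
      unfold scal, minus, plus, opp; simpl; unfold mult; simpl. field.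
      split; [assumption | lra].
Qed.

(** The reflection x -> 1-x changes the sign of the integrand, so the integral equals its own
    opposite. *)
Lemma is_RInt_logw_sym (n : nat) :
  is_RInt (fun x => logw x * (x ^ n * (1 - x) ^ n)) 0 1 0.
Proof.
  pose (f := fun x => logw x * (x ^ n * (1 - x) ^ n)). fold f.
  assert (Hex : ex_RInt f 0 1).
  { apply (ex_RInt_continuous (V := R_CompleteNormedModule)).
    rewrite Rmin_left, Rmax_right by lra. intros x Hx.
    apply continuous_logw_mult; [lra | now auto_derive]. }
  apply (RInt_correct (V := R_CompleteNormedModule)) in Hex.
  assert (Hs : is_RInt f 0 1 (- RInt f 0 1)).
  { apply is_RInt_ext with (fun y => scal (-1) (f (-1 * y + 1))).
    - intros x _. unfold f, scal; simpl; unfold mult; simpl.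
      replace (-1 * x + 1) with (1 - x) by ring. rewrite logw_sym.
      replace (1 - (1 - x)) with x by ring. ring.
    - apply (is_RInt_comp_lin f (-1) 1 0 1).
      replace (-1 * 0 + 1) with 1 by ring. replace (-1 * 1 + 1) with 0 by ring.
      now apply (is_RInt_swap (V := R_NormedModule)). }
  apply (is_RInt_unique (V := R_CompleteNormedModule)) in Hs.
  replace (RInt f 0 1) with 0 in Hex by lra. assumption.
Qed.

(* Integration by parts gives a recurrence in j; for j = 0 the integrand is odd about 1/2. *)
Lemma is_RInt_logw_beta (n j : nat) :
  is_RInt (fun x => logw x * (x ^ (n + j) * (1 - x) ^ n)) 0 1
    ((harmonic (S (n + j)) - harmonic (S n))
     * INR (fact (S (n + j))) * INR (fact (S n)) / INR (fact (n + j + n + 3))).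
Proof.
  induction j as [|j IH].
  - rewrite Nat.add_0_r, Rminus_diag.
    replace (0 * _ * _ / _) with 0 by (unfold Rdiv; ring). apply is_RInt_logw_sym.
  - replace (n + S j)%nat with (S (n + j)) by lia.
    set (m := (n + j)%nat) in *.
    pose proof (pos_INR n). pose proof (pos_INR m).
    assert (Hd : is_RInt (fun x => logw x * ((INR m + 2) * (x ^ m * (1 - x) ^ n)
        - (INR m + INR n + 4) * (x ^ S m * (1 - x) ^ n)) + x ^ S m * (1 - x) ^ S n) 0 1 0).
    { replace 0 with (0 - 0) at 2 by ring.
      (* The primitive is x^(m+2) (1-x)^(n+2) (ln x - ln (1-x)), which vanishes at both ends. *)
      apply (is_RInt_log (fun x => x ^ S m * (1 - x) ^ S (S n))
        (fun x => - (x ^ S (S m) * (1 - x) ^ S n)) (fun _ => 0));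
        try (intros x _; now auto_derive).
      - intros x Hx. apply (continuous_plus (V := R_NormedModule)).
        + apply continuous_logw_mult; [assumption | now auto_derive].
        + apply (ex_derive_continuous (V := R_NormedModule)). now auto_derive.
      - intros x Hx. auto_derive; [repeat split; lra |].
        rewrite !S_INR. unfold logw. simpl. unfold Rminus. field. lra. }
    (* With J(j) the integral for j, this is (m+n+4) J(j+1) = (m+2) J(j) + the Beta integral with
       exponents m+1, n+1; the latter supplies the new harmonic term. *)
    pose proof (is_RInt_minus _ _ _ _ _ _ (is_RInt_plus _ _ _ _ _ _
      (is_RInt_scal _ _ _ (INR m + 2) _ IH) (is_RInt_beta (S m) (S n))) Hd) as Hm.
    apply (is_RInt_scal _ _ _ (/ (INR m + INR n + 4))) in Hm.
    apply (is_RInt_congr _ _ _ _ _ _ Rle_0_1 Hm).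
    + intros x _.
      unfold scal, minus, plus, opp; simpl; unfold mult; simpl. field. lra.
    + replace (S m + S n + 1)%nat with (m + n + 3)%nat by lia.
      replace (S m + n + 3)%nat with (S (m + n + 3)) by lia.
      rewrite (INR_fact_S (m + n + 3)), (harmonic_S (S m)), (INR_fact_S (S m)).
      rewrite !plus_INR. replace (INR 3) with 3 by (rewrite INR_IZR_INZ; reflexivity). rewrite !S_INR.
      pose proof (INR_fact_neq_0 (m + n + 3)).
      unfold scal, minus, plus, opp; cbn -[fact]; unfold mult; cbn -[fact]. field.
      repeat split; try assumption; try lra. exact R1_neq_R0.
Qed.

Lemma is_RInt_summand (k : nat) :
  is_RInt (fun x => (ln x - ln (1 - x)) * (INR k * (- (x ^ 2 * (1 - x)) / 4) ^ k) / 4) 0 1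
    ((harmonic (2 * k) - harmonic k) / ((3 * INR k + 1) * Binomial.C (3 * k) k)
       * ((-1) ^ k * INR k / 4 ^ (k + 1))).
Proof.
  destruct k as [|k].
  (* The reduction below uses the exponent k-1, so k = 0 is separate; there the factor [INR k]
     annihilates both sides. *)
  - change (INR 0) with 0. apply is_RInt_zero; [lra | intros x _ |]; unfold Rdiv; ring.
  (* The exponents 2k+1 and k, raised by the factor x (1-x) of [logw], become 2(k+1) and k+1. *)
  - pose proof (is_RInt_logw_beta k (S k)) as H.
    apply (is_RInt_scal _ _ _ ((-1) ^ S k * INR (S k) / 4 ^ (S k + 1))) in H.
    apply (is_RInt_congr _ _ _ _ _ _ Rle_0_1 H).
    + intros x _. unfold scal; simpl; unfold mult; simpl.
      replace (- (x * (x * 1) * (1 - x)) / 4) with ((-1) * (x * x * (1 - x)) * / 4) by field.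
      rewrite !Rpow_mult_distr, pow_inv, !pow_add. simpl. unfold logw.
      assert (4 ^ k <> 0) by (apply pow_nonzero; lra). field. assumption.
    + replace (S (k + S k)) with (2 * S k)%nat by lia.
      replace (k + S k + k + 3)%nat with (S (3 * S k)) by lia.
      unfold Binomial.C. replace (3 * S k - S k)%nat with (2 * S k)%nat by lia.
      rewrite (INR_fact_S (3 * S k)), mult_INR.
      replace (INR 3) with 3 by (rewrite INR_IZR_INZ; reflexivity).
      assert (4 ^ (S k + 1) <> 0) by (apply pow_nonzero; lra).
      pose proof (INR_fact_neq_0 (3 * S k)). pose proof (INR_fact_neq_0 (2 * S k)).
      pose proof (INR_fact_neq_0 (S k)). pose proof (pos_INR (S k)).
      unfold scal; cbn -[fact INR harmonic Nat.mul pow Nat.add];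
      unfold mult; cbn -[fact INR harmonic Nat.mul pow Nat.add].
      field. repeat split; try assumption; lra.
Qed.

(** The exact tail of z/(1-z)^2, the sum of all k z^k, as an algebraic identity that can then be
    estimated uniformly in z. *)
Lemma sum_n_pow_deriv (z : R) (n : nat) :
  z <> 1 ->
  z / (1 - z) ^ 2 - sum_n (fun k => INR k * z ^ k) n
  = z ^ S n * (INR (S n) * (1 - z) + z) / (1 - z) ^ 2.
Proof.
  intros Hz. assert (1 - z <> 0) by lra. induction n as [|n IH].
  - rewrite sum_O. change (INR 0) with 0. change (INR 1) with 1. simpl. field. lra.
  - rewrite sum_Sn, (S_INR (S n)).
    change (z / (1 - z) ^ 2 - (sum_n (fun k => INR k * z ^ k) n + INR (S n) * z ^ S n)
      = z ^ S (S n) * ((INR (S n) + 1) * (1 - z) + z) / (1 - z) ^ 2).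
    replace (z / (1 - z) ^ 2 - (sum_n (fun k => INR k * z ^ k) n + INR (S n) * z ^ S n))
      with ((z / (1 - z) ^ 2 - sum_n (fun k => INR k * z ^ k) n) - INR (S n) * z ^ S n) by ring.
    rewrite IH, <- (tech_pow_Rmult z (S n)). field. assumption.
Qed.

Lemma is_RInt_sum_n (f : nat -> R -> R) (l : nat -> R) (a b : R) (n : nat) :
  (forall k, is_RInt (f k) a b (l k)) ->
  is_RInt (fun x => sum_n (fun k => f k x) n) a b (sum_n l n).
Proof.
  intros Hf. induction n as [|n IH].
  - rewrite sum_O. apply is_RInt_ext with (f 0%nat); [intros; now rewrite sum_O | apply Hf].
  - rewrite sum_Sn. apply is_RInt_ext with (fun x => plus (sum_n (fun k => f k x) n) (f (S n) x));
      [intros; now rewrite sum_Sn |].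
    apply (is_RInt_plus (V := R_NormedModule)); [exact IH | apply Hf].
Qed.

(** With z = - x^2 (1-x)/4 this is (ln x - ln (1-x)) z / (4 (1-z)^2), because 4 (1-z) = (2-x)
    (x^2+x+2). *)
Definition integrand (x : R) : R :=
  logw x * (- x / ((2 - x) ^ 2 * (x ^ 2 + x + 2) ^ 2)).

(** One factor z of the tail z^(n+1) is spent on turning the unbounded logarithm into the bounded
    [logw]; the other n factors are at most 1/4 in absolute value. The bound is thus uniform in
    x. *)
Lemma summand_remainder_bound (n : nat) (x : R) :
  0 < x < 1 ->
  Rabs (integrand x
    - sum_n (fun k => (ln x - ln (1 - x)) * (INR k * (- (x ^ 2 * (1 - x)) / 4) ^ k) / 4) n)
  <= (INR n + 2) * (1 / 4) ^ n.
Proof.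
  intros Hx. set (z := - (x ^ 2 * (1 - x)) / 4).
  assert (Hx2 : 0 <= x ^ 2 * (1 - x) <= 1).
  { assert (0 <= x ^ 2 <= 1) by (simpl; nra). nra. }
  assert (Hz : -1 / 4 <= z <= 0) by (unfold z; lra).
  assert (Hq : 0 < x ^ 2 + x + 2) by (simpl; nra).
  assert (E : integrand x = (ln x - ln (1 - x)) / 4 * (z / (1 - z) ^ 2)).
  { unfold integrand, logw.
    assert (1 - z = (2 - x) * (x ^ 2 + x + 2) / 4) by (unfold z; field).
    rewrite H. unfold z. field. split; lra. }
  assert (Es : sum_n (fun k => (ln x - ln (1 - x)) * (INR k * z ^ k) / 4) n
    = (ln x - ln (1 - x)) / 4 * sum_n (fun k => INR k * z ^ k) n).
  { rewrite (sum_n_ext _ (fun k => mult ((ln x - ln (1 - x)) / 4) (INR k * z ^ k)))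
      by (intros; unfold mult; simpl; field).
    apply (sum_n_mult_l (K := R_Ring)). }
  rewrite E, Es, <- Rmult_minus_distr_l, sum_n_pow_deriv by lra.
  pose proof (pos_INR n).
  replace ((ln x - ln (1 - x)) / 4 * (z ^ S n * (INR (S n) * (1 - z) + z) / (1 - z) ^ 2))
    with (logw x * (- x / 16) * z ^ n * ((INR (S n) * (1 - z) + z) / (1 - z) ^ 2)).
  2: { replace (logw x * (- x / 16)) with ((ln x - ln (1 - x)) / 4 * z)
         by (unfold logw, z; field).
       rewrite <- (tech_pow_Rmult z n). field. lra. }
  rewrite !Rabs_mult, <- RPow_abs.
  assert (H1 : Rabs (logw x) <= 1) by (apply Rabs_logw_le_1; lra).
  assert (H2 : Rabs (- x / 16) <= 1) by (apply Rabs_le; lra).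
  assert (H3 : Rabs z ^ n <= (1 / 4) ^ n).
  { apply pow_incr. split; [apply Rabs_pos | apply Rabs_le; lra]. }
  assert (H4 : Rabs ((INR (S n) * (1 - z) + z) / (1 - z) ^ 2) <= INR n + 2).
  { rewrite S_INR. assert (Hp : 1 <= (1 - z) ^ 2) by (simpl; nra).
    apply Rabs_le. split.
    - apply Rmult_le_reg_r with ((1 - z) ^ 2); [lra |]. unfold Rdiv.
      rewrite Rmult_assoc, Rinv_l, Rmult_1_r by lra. nra.
    - apply Rmult_le_reg_r with ((1 - z) ^ 2); [lra |]. unfold Rdiv.
      rewrite Rmult_assoc, Rinv_l, Rmult_1_r by lra. simpl. nra. }
  pose proof (Rabs_pos (logw x)). pose proof (Rabs_pos (- x / 16)).
  assert (0 <= Rabs z ^ n) by (apply pow_le, Rabs_pos).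
  pose proof (Rabs_pos ((INR (S n) * (1 - z) + z) / (1 - z) ^ 2)).
  rewrite (Rmult_comm (INR n + 2)).
  apply Rmult_le_compat; try assumption.
  - repeat apply Rmult_le_pos; assumption.
  - rewrite <- (Rmult_1_l ((1 / 4) ^ n)). apply Rmult_le_compat; try assumption.
    + now apply Rmult_le_pos.
    + rewrite <- (Rmult_1_l 1). now apply Rmult_le_compat.
Qed.

(** Integrating the uniform remainder bound over [0,1] bounds the distance from the partial sums to
    I, and replaces any theorem on exchanging sum and integral. *)
Lemma is_series_summand (I : R) :
  is_RInt integrand 0 1 I ->
  is_series
    (fun k : nat =>
       (harmonic (2 * k) - harmonic k) / ((3 * INR k + 1) * Binomial.C (3 * k) k)
       * ((-1) ^ k * INR k / 4 ^ (k + 1))) I.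
Proof.
  intros HI. set (a := fun k : nat => _).
  assert (Hb : forall n, Rabs (sum_n a n - I) <= 2 * (1 / 2) ^ n).
  { intros n. rewrite Rabs_minus_sym.
    pose proof (is_RInt_minus _ _ _ _ _ _ HI (is_RInt_sum_n _ _ _ _ n is_RInt_summand)) as H.
    pose proof (is_RInt_const (V := R_NormedModule) 0 1 ((INR n + 2) * (1 / 4) ^ n)) as Hc.
    assert (Hn : Rabs (I - sum_n a n) <= scal (1 - 0) ((INR n + 2) * (1 / 4) ^ n)).
    { apply Rabs_le. split.
      - apply (is_RInt_le _ _ _ _ _ _ Rle_0_1
          (is_RInt_opp (V := R_NormedModule) _ _ _ _ Hc) H).
        intros x Hx. apply (proj1 (Rabs_le_between _ _) (summand_remainder_bound n x Hx)).
      - apply (is_RInt_le _ _ _ _ _ _ Rle_0_1 H Hc).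
        intros x Hx. apply (proj1 (Rabs_le_between _ _) (summand_remainder_bound n x Hx)). }
    replace (scal (1 - 0) ((INR n + 2) * (1 / 4) ^ n)) with ((INR n + 2) * (1 / 4) ^ n) in Hn
      by (unfold scal; simpl; unfold mult; simpl; ring).
    apply Rle_trans with (1 := Hn).
    (* The linear factor is absorbed by 2^n, which leaves the geometric rate 1/2 out of 1/4. *)
    assert (Hp : INR n + 2 <= 2 * 2 ^ n).
    { clear. induction n as [|n IH]; [change (INR 0) with 0; simpl; lra |].
      rewrite S_INR. simpl. pose proof (pos_INR n). lra. }
    replace (1 / 4) with (1 / 2 * (1 / 2)) by field. rewrite Rpow_mult_distr.
    assert (H2 : 2 ^ n * (1 / 2) ^ n = 1)
      by (rewrite <- Rpow_mult_distr; replace (2 * (1 / 2)) with 1 by field; apply pow1).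
    assert (0 < (1 / 2) ^ n) by (apply pow_lt; lra). nra. }
  change (is_lim_seq (sum_n a) I). apply is_lim_seq_spec.
  pose proof (is_lim_seq_scal_l _ 2 _ (is_lim_seq_geom (1 / 2) ltac:(rewrite Rabs_right; lra))) as Hl.
  rewrite Rbar_mult_0_r in Hl. apply is_lim_seq_spec in Hl.
  intros eps. destruct (Hl eps) as [N HN]. exists N. intros n Hn.
  specialize (HN n Hn). rewrite Rminus_0_r in HN.
  apply Rle_lt_trans with (1 := Hb n). apply Rle_lt_trans with (2 := HN). apply Rle_abs.
Qed.

End Series.

(** * Differentiation under the integral sign *)

Lemma clamp_lipschitz (a b x y : R) :
  a <= b -> Rabs (clamp a b x - clamp a b y) <= Rabs (x - y).
Proof.
  intros Hab. unfold clamp, Rmax, Rmin, Rabs.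
  repeat (destruct (Rle_dec _ _) || destruct (Rcase_abs _)); lra.
Qed.

Lemma continuity_2d_pt_clamp (g : R -> R -> R) (a b q x : R) :
  a <= x <= b -> continuity_2d_pt g q x ->
  continuity_2d_pt (fun u v => g u (clamp a b v)) q x.
Proof.
  intros Hx Hg eps. destruct (Hg eps) as [d Hd]. exists d. intros u v Hu Hv.
  rewrite (clamp_id a b x Hx). apply Hd; [assumption |].
  apply Rle_lt_trans with (2 := Hv). rewrite <- (clamp_id a b x Hx) at 1.
  apply clamp_lipschitz; lra.
Qed.

(* Both sides have the same derivative in the parameter. In the proof, the clamp keeps the
   integrand well behaved outside [a,b], as Coquelicot's [is_derive_RInt_param] demands. *)
Lemma is_RInt_param (w : R -> R) (f df : R -> R -> R) (V dV : R -> R) (a b lo q0 q1 : R) :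
  a <= b -> lo < q0 -> lo < q1 ->
  (forall x, a <= x <= b -> continuous w x) ->
  (forall q x, lo < q -> a <= x <= b -> is_derive (fun q => f q x) q (df q x)) ->
  (forall q x, lo < q -> a <= x <= b -> continuity_2d_pt df q x) ->
  (forall q x, lo < q -> a <= x <= b -> continuous (f q) x) ->
  (forall q, lo < q -> is_RInt (fun x => w x * df q x) a b (dV q)) ->
  (forall q, lo < q -> is_derive V q (dV q)) ->
  is_RInt (fun x => w x * f q0 x) a b (V q0) ->
  is_RInt (fun x => w x * f q1 x) a b (V q1).
Proof.
  intros Hab Hq0 Hq1 Hw Hf Hdf Hfc HdV HV H0.
  pose (F := fun q x => w (clamp a b x) * f q (clamp a b x)).
  assert (Hex : forall q, lo < q -> ex_RInt (fun x => w x * f q x) a b).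
  { intros q Hq. apply (ex_RInt_continuous (V := R_CompleteNormedModule)).
    rewrite Rmin_left, Rmax_right by lra. intros x Hx.
    apply (continuous_mult w); [now apply Hw | now apply Hfc]. }
  assert (HF : forall q x, a < x < b -> w x * f q x = F q x).
  { intros q x Hx. unfold F. rewrite clamp_id by lra. reflexivity. }
  assert (HexF : forall q, lo < q -> ex_RInt (F q) a b).
  { intros q Hq. destruct (Hex q Hq) as [v Hv]. exists v. revert Hv. apply is_RInt_ext.
    rewrite Rmin_left, Rmax_right by lra. intros; now apply HF. }
  assert (HdF : forall q x, lo < q ->
      is_derive (fun q => F q x) q (w (clamp a b x) * df q (clamp a b x))).
  { intros q x Hq. apply (is_derive_scal (fun q => f q (clamp a b x))).
    apply Hf; [assumption | now apply clamp_bounds]. }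
  assert (HI : forall q, lo < q -> is_derive (fun q => RInt (F q) a b) q (dV q)).
  { intros q Hq.
    assert (Hloc : locally q (fun y => lo < y)) by now apply open_gt.
    replace (dV q) with (RInt (fun x => Derive (fun u => F u x) q) a b).
    - apply is_derive_RInt_param.
      + revert Hloc. apply filter_imp. intros y Hy x _. eexists. now apply HdF.
      + rewrite Rmin_left, Rmax_right by lra. intros x Hx.
        apply continuity_2d_pt_ext_loc with
          (fun u v => w (clamp a b v) * df u (clamp a b v)).
        * destruct Hloc as [d Hd]. exists d. intros u v Hu _.
          symmetry. apply is_derive_unique, HdF. now apply Hd.
        * apply continuity_2d_pt_mult.
          -- apply (continuity_1d_2d_pt_comp (fun v => w (clamp a b v)) (fun _ v => v));
               [| apply continuity_2d_pt_id2].
             apply continuity_pt_filterlim. apply (continuous_comp (clamp a b) w).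
             ++ now apply continuous_clamp.
             ++ apply Hw, clamp_bounds, Hab.
          -- apply (continuity_2d_pt_clamp df); [assumption | now apply Hdf].
      + revert Hloc. apply filter_imp. exact HexF.
    - apply (is_RInt_unique (V := R_CompleteNormedModule)).
      apply is_RInt_ext with (fun x => w x * df q x); [| now apply HdV].
      rewrite Rmin_left, Rmax_right by lra. intros x Hx.
      symmetry. apply is_derive_unique. specialize (HdF q x Hq). now rewrite clamp_id in HdF by lra. }
  assert (Hd0 : forall q, lo < q -> is_derive (fun q => RInt (F q) a b - V q) q 0).
  { intros q Hq. replace 0 with (minus (dV q) (dV q))
      by (unfold minus, plus, opp; simpl; ring).
    apply (is_derive_minus (K := R_AbsRing) (V := R_NormedModule)); [now apply HI | now apply HV]. }
  assert (Hlo : lo < Rmin q0 q1) by (now apply Rmin_glb_lt).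
  destruct (MVT_gen (fun q => RInt (F q) a b - V q) q0 q1 (fun _ => 0)) as [c [_ Hc]].
  - intros q Hq. apply Hd0. lra.
  - intros q Hq. apply continuity_pt_filterlim.
    apply (ex_derive_continuous (V := R_NormedModule) (fun q => RInt (F q) a b - V q)).
    exists 0. apply Hd0. lra.
  - assert (E : RInt (F q0) a b = V q0).
    { apply (is_RInt_unique (V := R_CompleteNormedModule)). revert H0. apply is_RInt_ext.
      rewrite Rmin_left, Rmax_right by lra. intros; now apply HF. }
    replace (V q1) with (RInt (F q1) a b) by lra.
    apply is_RInt_ext with (F q1).
    + rewrite Rmin_left, Rmax_right by lra. intros; symmetry; now apply HF.
    + apply (RInt_correct (V := R_CompleteNormedModule)). now apply HexF.
Qed.

(** * The logarithmic integrals of the kernels, for real and then for complex a *)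

Ltac continuity_2d :=
  repeat first
    [ apply continuity_2d_pt_plus | apply continuity_2d_pt_minus | apply continuity_2d_pt_opp
    | apply continuity_2d_pt_mult | apply continuity_2d_pt_inv
    | apply continuity_2d_pt_id1 | apply continuity_2d_pt_id2 | apply continuity_2d_pt_const ].

(* This is [-(1-a)^3 / (a (x + a(1-x)))] for [a = r]; multiplied by [x(1-x)] it is [(1-a)/(x +
   a(1-x))] minus the affine function with the same values at 0 and 1, which removes the
   singularities of the logarithms. *)
Definition real_kernel (r x : R) : R := - (1 - r) ^ 3 / (r * (x + r * (1 - x))).

(** The first term is the integral for the pole, -ln(a)^2/2; the second accounts for the subtracted
    affine function, of slope -(1-a)^2/a, since x ln(x/(1-x)) integrates to 1/2. The parameter runs
    from 1, where the kernel is identically 0. *)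
Lemma is_RInt_real_kernel (r : R) :
  0 < r ->
  is_RInt (fun x => logw x * real_kernel r x) 0 1
    (- (ln r) ^ 2 / 2 + (1 - r) ^ 2 / (2 * r)).
Proof.
  intros Hr.
  assert (HD : forall q x, 0 < q -> 0 <= x <= 1 -> 0 < x + q * (1 - x)).
  { intros q x Hq Hx. destruct (Rle_lt_dec x (1 / 2)); nra. }
  apply (is_RInt_param logw real_kernel
    (fun q x => 3 * (1 - q) * (1 - q) * / (q * (x + q * (1 - x)))
       + (1 - q) * (1 - q) * (1 - q) * (x + 2 * q * (1 - x))
         * / (q * q * (x + q * (1 - x)) * (x + q * (1 - x))))
    (fun q => - (ln q) ^ 2 / 2 + (1 - q) ^ 2 / (2 * q))
    (fun q => - ln q / q - 1 / (2 * q ^ 2) + 1 / 2) 0 1 0 1 r); try lra.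
  - exact continuous_logw.
  - intros q x Hq Hx. pose proof (HD q x Hq Hx). unfold real_kernel. auto_derive.
    + apply Rgt_not_eq. now apply Rmult_lt_0_compat.
    + field. split; lra.
  - intros q x Hq Hx. pose proof (HD q x Hq Hx). continuity_2d; apply Rgt_not_eq;
      repeat apply Rmult_lt_0_compat; assumption.
  - intros q x Hq Hx. pose proof (HD q x Hq Hx). unfold real_kernel.
    apply (ex_derive_continuous (V := R_NormedModule)). auto_derive.
    apply Rgt_not_eq. now apply Rmult_lt_0_compat.
  - intros q Hq.
    (* Here x A and -(1-x) B are the primitives, vanishing at 0 and at 1 respectively, of the factor
       multiplying ln x - ln (1-x); integration by parts then forces C' = B - A. *)
    pose (A := fun x => - / (q * (x + q * (1 - x))) + (1 - x / 2) / q ^ 2 + x / 2).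
    pose (B := fun x => - / (x + q * (1 - x)) + (1 - x) / (2 * q ^ 2) + (1 + x) / 2).
    pose (C := fun x => ln (x + q * (1 - x)) / q - x / (2 * q ^ 2) + x / 2).
    replace (- ln q / q - 1 / (2 * q ^ 2) + 1 / 2) with (C 1 - C 0).
    + apply (is_RInt_log A B C).
      * intros x Hx. pose proof (HD q x Hq Hx). unfold A. auto_derive.
        apply Rgt_not_eq. now apply Rmult_lt_0_compat.
      * intros x Hx. pose proof (HD q x Hq Hx). unfold B. auto_derive. lra.
      * intros x Hx. pose proof (HD q x Hq Hx). unfold C. now auto_derive.
      * intros x Hx. pose proof (HD q x Hq Hx). apply continuous_logw_mult; [assumption |].
        auto_derive. repeat split; apply Rgt_not_eq; repeat apply Rmult_lt_0_compat; assumption.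
      * intros x Hx. assert (0 < x + q * (1 - x)) by (apply HD; lra).
        unfold A, B, C, logw. auto_derive.
        -- repeat split; try lra. apply Rgt_not_eq. now apply Rmult_lt_0_compat.
        -- unfold Rminus. field. repeat split; lra.
    + unfold C. replace (1 + q * (1 - 1)) with 1 by ring. replace (0 + q * (1 - 0)) with q by ring.
      rewrite ln_1. field. lra.
  - intros q Hq. auto_derive; [lra |]. field. lra.
  - apply is_RInt_zero; [lra | |].
    + intros x _. unfold real_kernel, Rdiv. ring.
    + rewrite ln_1. field.
Qed.

(* Real and imaginary parts, for [a = p + i q], of [(1-a)^3], of [-(1-a)^3 conj(a)] and of the
   kernel [-(1-a)^3 / (a (x + a(1-x)))]; primes denote derivatives in [q]. *)
Definition cube_re (p q : R) : R := (1 - p) * (1 - p) * (1 - p) - 3 * (1 - p) * q * q.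
Definition cube_im (p q : R) : R := q * q * q - 3 * (1 - p) * (1 - p) * q.
Definition num_re (p q : R) : R := - (cube_re p q * p + cube_im p q * q).
Definition num_im (p q : R) : R := cube_re p q * q - cube_im p q * p.
Definition num_re' (p q : R) : R :=
  - (3 * (- 2 * (1 - p) * q * p - ((1 - p) * (1 - p) - q * q) * q) + cube_im p q).
Definition num_im' (p q : R) : R :=
  3 * (((1 - p) * (1 - p) - q * q) * p - 2 * (1 - p) * q * q) + cube_re p q.
Definition lin (p x : R) : R := x + p * (1 - x).
Definition sqnorm (p q x : R) : R := lin p x * lin p x + q * q * (1 - x) * (1 - x).
Definition kernel_re (p q x : R) : R :=
  (num_re p q * lin p x + num_im p q * q * (1 - x)) / ((p * p + q * q) * sqnorm p q x).
Definition kernel_im (p q x : R) : R :=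
  (num_im p q * lin p x - num_re p q * q * (1 - x)) / ((p * p + q * q) * sqnorm p q x).
Definition kernel_re' (p q x : R) : R :=
  (num_re' p q * lin p x + (num_im' p q * q + num_im p q) * (1 - x))
    * / ((p * p + q * q) * sqnorm p q x)
  - (num_re p q * lin p x + num_im p q * q * (1 - x))
    * (2 * q * sqnorm p q x + (p * p + q * q) * (2 * q * (1 - x) * (1 - x)))
    * / ((p * p + q * q) * sqnorm p q x * ((p * p + q * q) * sqnorm p q x)).
Definition kernel_im' (p q x : R) : R :=
  (num_im' p q * lin p x - (num_re' p q * q + num_re p q) * (1 - x))
    * / ((p * p + q * q) * sqnorm p q x)
  - (num_im p q * lin p x - num_re p q * q * (1 - x))
    * (2 * q * sqnorm p q x + (p * p + q * q) * (2 * q * (1 - x) * (1 - x)))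
    * / ((p * p + q * q) * sqnorm p q x * ((p * p + q * q) * sqnorm p q x)).

Ltac unfold_kernel :=
  unfold kernel_re, kernel_im, kernel_re', kernel_im', num_re, num_im, num_re', num_im', cube_re, cube_im, sqnorm, lin.

Lemma lin_pos (p x : R) : 0 < p -> 0 <= x <= 1 -> 0 < lin p x.
Proof. intros Hp Hx. unfold lin. destruct (Rle_lt_dec x (1 / 2)); nra. Qed.

Lemma sqnorm_pos (p q x : R) : 0 < p -> 0 <= x <= 1 -> 0 < sqnorm p q x.
Proof.
  intros Hp Hx. pose proof (lin_pos p x Hp Hx). unfold sqnorm.
  pose proof (Rle_0_sqr (q * (1 - x))). unfold Rsqr in *. nra.
Qed.

Lemma kernel_den_neq_0 (p q x : R) :
  0 < p -> 0 <= x <= 1 -> (p * p + q * q) * sqnorm p q x <> 0.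
Proof.
  intros Hp Hx. apply Rgt_not_eq, Rmult_lt_0_compat; [nra | now apply sqnorm_pos].
Qed.

Lemma is_derive_kernel_re (p q x : R) :
  0 < p -> 0 <= x <= 1 -> is_derive (fun q => kernel_re p q x) q (kernel_re' p q x).
Proof.
  intros Hp Hx. pose proof (kernel_den_neq_0 p q x Hp Hx) as H. revert H.
  unfold_kernel. intros H. auto_derive; [exact H |]. unfold Rminus in *. field.
  split; intros E; apply H; rewrite E; ring.
Qed.

Lemma is_derive_kernel_im (p q x : R) :
  0 < p -> 0 <= x <= 1 -> is_derive (fun q => kernel_im p q x) q (kernel_im' p q x).
Proof.
  intros Hp Hx. pose proof (kernel_den_neq_0 p q x Hp Hx) as H. revert H.
  unfold_kernel. intros H. auto_derive; [exact H |]. unfold Rminus in *. field.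
  split; intros E; apply H; rewrite E; ring.
Qed.

(* The argument of [x + a(1-x)], whose squared modulus is [sqnorm]. *)
Definition arg (p q x : R) : R := atan (q * (1 - x) / lin p x).

(** As d/dq = i d/da, the value is the real part of i (- Log a/a - 1/(2a^2) + 1/2) with a = p + i q,
    the derivative found on the real axis. Likewise [A], [B], [C] are real parts of i times their
    real-axis counterparts. *)
Lemma is_RInt_kernel_re' (p q : R) :
  0 < p ->
  is_RInt (fun x => logw x * kernel_re' p q x) 0 1
    ((p * atan (q / p) - q * (ln (p * p + q * q) / 2)) / (p * p + q * q)
     - p * q / (p * p + q * q) ^ 2).
Proof.
  intros Hp.
  pose (A := fun x => - (q * (p * (1 - x) + lin p x)) / ((p * p + q * q) * sqnorm p q x)
    + (1 - x / 2) * (2 * p * q) / (p * p + q * q) ^ 2).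
  pose (B := fun x => - (q * (1 - x)) / sqnorm p q x + (1 - x) * (p * q) / (p * p + q * q) ^ 2).
  pose (C := fun x => (q * (ln (sqnorm p q x) / 2) - p * arg p q x) / (p * p + q * q)
    - x * (p * q) / (p * p + q * q) ^ 2).
  assert (Hn : p * p + q * q <> 0) by nra.
  replace (_ - _) with (C 1 - C 0).
  - apply (is_RInt_log A B C).
    + intros x Hx. pose proof (kernel_den_neq_0 p q x Hp Hx) as H.
      unfold A. unfold sqnorm, lin in *. now auto_derive.
    + intros x Hx. pose proof (sqnorm_pos p q x Hp Hx) as H.
      unfold B. unfold sqnorm, lin in *. auto_derive. now apply Rgt_not_eq.
    + intros x Hx. pose proof (sqnorm_pos p q x Hp Hx) as H. pose proof (lin_pos p x Hp Hx).
      unfold C, arg. unfold sqnorm, lin in *. auto_derive. split; [assumption |].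
      split; [now apply Rgt_not_eq | trivial].
    + intros x Hx. pose proof (kernel_den_neq_0 p q x Hp Hx) as H.
      apply continuous_logw_mult; [assumption |]. revert H. unfold_kernel. intros H.
      auto_derive. repeat split; try assumption. now apply Rmult_integral_contrapositive.
    + intros x Hx0. assert (Hx : 0 <= x <= 1) by lra.
      pose proof (sqnorm_pos p q x Hp Hx) as H. pose proof (lin_pos p x Hp Hx).
      pose proof (kernel_den_neq_0 p q x Hp Hx) as H1.
      unfold A, B, C, arg, logw. revert H H0 H1. unfold_kernel. intros H H0 H1. auto_derive.
      * repeat split; try assumption; try lra. 
      * unfold Rminus in *. field. repeat split; try assumption; try lra; try nra.
  - unfold C, arg, sqnorm, lin.
    replace (q * (1 - 1) / (1 + p * (1 - 1))) with 0 by (field; lra).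
    replace (q * (1 - 0) / (0 + p * (1 - 0))) with (q / p) by (field; lra).
    replace ((1 + p * (1 - 1)) * (1 + p * (1 - 1)) + q * q * (1 - 1) * (1 - 1)) with 1 by ring.
    replace ((0 + p * (1 - 0)) * (0 + p * (1 - 0)) + q * q * (1 - 0) * (1 - 0))
      with (p * p + q * q) by ring.
    rewrite ln_1, atan_0. field. assumption.
Qed.

(** The imaginary part of the same complex identity. *)
Lemma is_RInt_kernel_im' (p q : R) :
  0 < p ->
  is_RInt (fun x => logw x * kernel_im' p q x) 0 1
    (- (p * (ln (p * p + q * q) / 2) + q * atan (q / p)) / (p * p + q * q)
     - (p * p - q * q) / (2 * (p * p + q * q) ^ 2) + 1 / 2).
Proof.
  intros Hp.
  pose (A := fun x => - (p * lin p x - q * q * (1 - x)) / ((p * p + q * q) * sqnorm p q x)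
    + (1 - x / 2) * (p * p - q * q) / (p * p + q * q) ^ 2 + x / 2).
  pose (B := fun x => - lin p x / sqnorm p q x
    + (1 - x) * (p * p - q * q) / (2 * (p * p + q * q) ^ 2) + (1 + x) / 2).
  pose (C := fun x => (p * (ln (sqnorm p q x) / 2) + q * arg p q x) / (p * p + q * q)
    - x * (p * p - q * q) / (2 * (p * p + q * q) ^ 2) + x / 2).
  assert (Hn : p * p + q * q <> 0) by nra.
  replace (_ + 1 / 2) with (C 1 - C 0).
  - apply (is_RInt_log A B C).
    + intros x Hx. pose proof (kernel_den_neq_0 p q x Hp Hx) as H.
      unfold A. unfold sqnorm, lin in *. now auto_derive.
    + intros x Hx. pose proof (sqnorm_pos p q x Hp Hx) as H.
      unfold B. unfold sqnorm, lin in *. auto_derive. now apply Rgt_not_eq.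
    + intros x Hx. pose proof (sqnorm_pos p q x Hp Hx) as H. pose proof (lin_pos p x Hp Hx).
      unfold C, arg. unfold sqnorm, lin in *. auto_derive. split; [assumption |].
      split; [now apply Rgt_not_eq | trivial].
    + intros x Hx. pose proof (kernel_den_neq_0 p q x Hp Hx) as H.
      apply continuous_logw_mult; [assumption |]. revert H. unfold_kernel. intros H.
      auto_derive. repeat split; try assumption. now apply Rmult_integral_contrapositive.
    + intros x Hx0. assert (Hx : 0 <= x <= 1) by lra.
      pose proof (sqnorm_pos p q x Hp Hx) as H. pose proof (lin_pos p x Hp Hx).
      pose proof (kernel_den_neq_0 p q x Hp Hx) as H1.
      unfold A, B, C, arg, logw. revert H H0 H1. unfold_kernel. intros H H0 H1. auto_derive.
      * repeat split; try assumption; try lra.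
      * unfold Rminus in *. field. repeat split; try assumption; try lra; try nra.
  - unfold C, arg, sqnorm, lin.
    replace (q * (1 - 1) / (1 + p * (1 - 1))) with 0 by (field; lra).
    replace (q * (1 - 0) / (0 + p * (1 - 0))) with (q / p) by (field; lra).
    replace ((1 + p * (1 - 1)) * (1 + p * (1 - 1)) + q * q * (1 - 1) * (1 - 1)) with 1 by ring.
    replace ((0 + p * (1 - 0)) * (0 + p * (1 - 0)) + q * q * (1 - 0) * (1 - 0))
      with (p * p + q * q) by ring.
    rewrite ln_1, atan_0. field. assumption.
Qed.

(** The value is the real part of - Log(a)^2/2 + (1/a - 2 + a)/2, where (1-a)^2/(2a) has been
    expanded. The segment starts at q = 0, the real kernel at p; the bound -1 merely keeps that
    start inside the open range of the parameter. *)
Lemma is_RInt_kernel_re (p q : R) :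
  0 < p -> 0 <= q ->
  is_RInt (fun x => logw x * kernel_re p q x) 0 1
    (- ((ln (p * p + q * q) / 2) ^ 2 - (atan (q / p)) ^ 2) / 2
     + (p / (p * p + q * q) - 2 + p) / 2).
Proof.
  intros Hp Hq.
  apply (is_RInt_param logw (kernel_re p) (kernel_re' p)
    (fun q => - ((ln (p * p + q * q) / 2) ^ 2 - (atan (q / p)) ^ 2) / 2
       + (p / (p * p + q * q) - 2 + p) / 2)
    (fun q => (p * atan (q / p) - q * (ln (p * p + q * q) / 2)) / (p * p + q * q)
       - p * q / (p * p + q * q) ^ 2) 0 1 (-1) 0 q); try lra.
  - exact continuous_logw.
  - intros t x _ Hx. now apply is_derive_kernel_re.
  - intros t x _ Hx. pose proof (kernel_den_neq_0 p t x Hp Hx) as H. revert H.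
    unfold_kernel. intros H.
    continuity_2d; [assumption | now apply Rmult_integral_contrapositive].
  - intros t x _ Hx. pose proof (kernel_den_neq_0 p t x Hp Hx) as H. revert H.
    unfold_kernel. intros H. apply (ex_derive_continuous (V := R_NormedModule)). now auto_derive.
  - intros t _. now apply is_RInt_kernel_re'.
  - intros t _. assert (p * p + t * t > 0) by nra. auto_derive.
    + repeat split; lra.
    + unfold Rminus, Rdiv. field. repeat split; nra.
  - pose proof (is_RInt_real_kernel p Hp) as H.
    replace (0 / p) with 0 by (field; lra). rewrite atan_0, Rmult_0_r, Rplus_0_r.
    rewrite ln_mult by assumption.
    apply (is_RInt_congr _ _ _ _ _ _ Rle_0_1 H); [intros x Hx | field; lra].
    assert (0 < lin p x) by (apply lin_pos; lra). unfold real_kernel. fold (lin p x).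
    apply Rminus_diag_uniq. unfold kernel_re, num_re, num_im, cube_re, cube_im, sqnorm.
    field. split; lra.
Qed.

(** The corresponding imaginary part; at the start q = 0 the kernel is real and both sides
    vanish. *)
Lemma is_RInt_kernel_im (p q : R) :
  0 < p -> 0 <= q ->
  is_RInt (fun x => logw x * kernel_im p q x) 0 1
    (- (ln (p * p + q * q) / 2 * atan (q / p)) + (q - q / (p * p + q * q)) / 2).
Proof.
  intros Hp Hq.
  apply (is_RInt_param logw (kernel_im p) (kernel_im' p)
    (fun q => - (ln (p * p + q * q) / 2 * atan (q / p)) + (q - q / (p * p + q * q)) / 2)
    (fun q => - (p * (ln (p * p + q * q) / 2) + q * atan (q / p)) / (p * p + q * q)
     - (p * p - q * q) / (2 * (p * p + q * q) ^ 2) + 1 / 2) 0 1 (-1) 0 q); try lra.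
  - exact continuous_logw.
  - intros t x _ Hx. now apply is_derive_kernel_im.
  - intros t x _ Hx. pose proof (kernel_den_neq_0 p t x Hp Hx) as H. revert H.
    unfold_kernel. intros H.
    continuity_2d; [assumption | now apply Rmult_integral_contrapositive].
  - intros t x _ Hx. pose proof (kernel_den_neq_0 p t x Hp Hx) as H. revert H.
    unfold_kernel. intros H. apply (ex_derive_continuous (V := R_NormedModule)). now auto_derive.
  - intros t _. now apply is_RInt_kernel_im'.
  - intros t _. assert (p * p + t * t > 0) by nra. auto_derive.
    + repeat split; lra.
    + unfold Rminus, Rdiv. field. repeat split; nra.
  - replace (0 / p) with 0 by (field; lra). rewrite atan_0.
    apply is_RInt_zero; [lra | |].
    + intros x _. unfold kernel_im, num_re, num_im, cube_re, cube_im, Rdiv. ring.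
    + field. nra.
Qed.

(** * Partial fractions and the final evaluation *)

Lemma is_RInt_integrand :
  is_RInt integrand 0 1
    (3 / 448 * ln 2 - 9 / 512 * (ln 2) ^ 2
     - 3 / 128 * (atan (sqrt 7 / 5)) ^ 2
     - (1 / 224 - 89 / 6272 * ln 2) * sqrt 7 * atan (sqrt 7 / 5)).
Proof.
  assert (Hs : 0 < sqrt 7) by (apply sqrt_lt_R0; lra).
  assert (Hss : sqrt 7 * sqrt 7 = 7) by (apply sqrt_sqrt; lra).
  (* Only s > 0 and s * s = 7 are kept; [field [Hss]] uses the latter as a rewrite rule. *)
  generalize dependent (sqrt 7). intros s Hs Hss.
  assert (Hq : forall x, 0 < x ^ 2 + x + 2) by (intros x; simpl; nra).
  (* [rest] is what is left after matching the residues at 2 and at the roots of x^2 + x + 2,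
     which correspond to a = 2 and a = (5 + i sqrt 7)/8; its pairing with the logarithms is
     elementary. *)
  pose (rest := fun x => - x / ((2 - x) ^ 2 * (x ^ 2 + x + 2) ^ 2)
    - 3 / 128 / (2 - x) + 3 / 512 * (x + 4) / (x ^ 2 + x + 2)
    - 89 / 3584 * x / (x ^ 2 + x + 2)).
  (* [l0] and [l1] are the values at 0 and 1 of the affine functions subtracted in the kernels, one
     summand for each of the weights 3/64, -3/64 and 89 s/3136 used below. *)
  pose (l0 := - 3 / 128 - 3 / 256 - 89 / 1792).
  pose (l1 := - 3 / 64 - 9 / 512 - 89 / 3584).
  (* The arctangent is [arg (5 / 8) (s / 8) x], up to a factor a primitive of 1/(x^2+x+2),
     normalized to vanish at 1. *)
  pose (C := fun x => - (1 / 32) * ln (2 - x) - 11 / 448 * ln (x ^ 2 + x + 2)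
    + (9 / 224 - 11 / 448) * (2 / s) * atan (s * (1 - x) / (5 + 3 * x))
    - l0 * x / 2 + l1 * x / 2).
  assert (Hrest : is_RInt (fun x => logw x * rest x) 0 1 (C 1 - C 0)).
  { apply (is_RInt_log
      (fun x => / (32 * (2 - x)) + (9 / 112 + 13 / 224 * (x + 1)) / (x ^ 2 + x + 2)
         + l0 * (1 - x / 2) + l1 * x / 2)
      (fun x => / (16 * (2 - x)) - (- (1 / 112) * x - 11 / 112) / (x ^ 2 + x + 2)
         + l0 * (1 - x) / 2 + l1 * (1 + x) / 2) C).
    - intros x Hx. specialize (Hq x). auto_derive. repeat split; apply Rgt_not_eq; lra.
    - intros x Hx. specialize (Hq x). auto_derive. repeat split; apply Rgt_not_eq; lra.
    - intros x Hx. specialize (Hq x). unfold C. auto_derive. repeat split; lra.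
    - intros x Hx. specialize (Hq x). apply continuous_logw_mult; [assumption |].
      unfold rest. auto_derive. repeat split; apply Rgt_not_eq; try lra.
      repeat apply Rmult_lt_0_compat; lra.
    - intros x Hx. specialize (Hq x). unfold C, rest, l0, l1, logw. auto_derive.
      + repeat split; try lra; apply Rgt_not_eq; lra.
      + unfold Rminus, Rdiv. field [Hss].
        assert (0 < (5 + 3 * x) * (5 + 3 * x)) by nra.
        pose proof (Rle_0_sqr (s * (1 + - x))). unfold Rsqr in *.
        repeat split; lra. }
  pose proof (is_RInt_real_kernel 2 ltac:(lra)) as H2.
  pose proof (is_RInt_kernel_re (5 / 8) (s / 8) ltac:(lra) ltac:(lra)) as Hre.
  pose proof (is_RInt_kernel_im (5 / 8) (s / 8) ltac:(lra) ltac:(lra)) as Him.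
  (* The weight 3/64 restores the simple pole at 2, the other two those at the conjugate roots of
     x^2+x+2. *)
  pose proof (is_RInt_plus _ _ _ _ _ _ Hrest (is_RInt_plus _ _ _ _ _ _
    (is_RInt_scal _ _ _ (3 / 64) _ H2) (is_RInt_plus _ _ _ _ _ _
    (is_RInt_scal _ _ _ (- (3 / 64)) _ Hre) (is_RInt_scal _ _ _ (89 / 3136 * s) _ Him)))) as H.
  apply (is_RInt_congr _ _ _ _ _ _ Rle_0_1 H).
  - intros x Hx. unfold integrand.
    (* For a = (5 + i s)/8 the zero a/(a-1) of x + a(1-x) is (-1 - i s)/2, a root of x^2+x+2. *)
    assert (Er : kernel_re (5 / 8) (s / 8) x = (x + 4) / (8 * (x ^ 2 + x + 2))).
    { unfold_kernel. specialize (Hq x). field [Hss].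
      pose proof (Rle_0_sqr (x * 8 + 5 * (1 - x))). pose proof (Rle_0_sqr (1 - x)).
      unfold Rsqr in *. rewrite Hss. repeat split; nra. }
    assert (Ei : s * kernel_im (5 / 8) (s / 8) x = 7 * x / (8 * (x ^ 2 + x + 2))).
    { unfold_kernel. specialize (Hq x). field [Hss].
      pose proof (Rle_0_sqr (x * 8 + 5 * (1 - x))). pose proof (Rle_0_sqr (1 - x)).
      unfold Rsqr in *. rewrite Hss. repeat split; nra. }
    specialize (Hq x). unfold plus, scal; simpl; unfold mult; simpl.
    apply Rminus_diag_uniq.
    match goal with |- context [89 / 3136 * s * (logw x * ?k)] =>
      replace (89 / 3136 * s * (logw x * k)) with (89 / 3136 * logw x * (s * k)) by ring end.
    rewrite Er, Ei. unfold rest, real_kernel. field. split; lra.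
  - unfold plus, scal; simpl; unfold mult; simpl. unfold C, l0, l1.
    replace (s / 8 / (5 / 8)) with (s / 5) by field.
    (* The squared modulus of a is 1/2, so its logarithm too is a multiple of ln 2. *)
    replace (5 / 8 * (5 / 8) + s / 8 * (s / 8)) with (/ 2) by lra.
    replace (s * (1 - 1) / (5 + 3 * 1)) with 0 by field.
    replace (s * (1 - 0) / (5 + 3 * 0)) with (s / 5) by field.
    replace (1 ^ 2 + 1 + 2) with (2 * 2) by ring.
    replace (0 ^ 2 + 0 + 2) with 2 by ring.
    replace (2 - 1) with 1 by ring. replace (2 - 0) with 2 by ring.
    rewrite ln_Rinv, ln_mult, ln_1, atan_0 by lra.
    field [Hss]. lra.
Qed.

Theorem mainTheorem4 :
  is_series
    (fun k : nat =>
       (harmonic (2 * k) - harmonic k) / ((3 * INR k + 1) * Binomial.C (3 * k) k)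
       * ((-1) ^ k * INR k / 4 ^ (k + 1)))
    (3 / 448 * ln 2 - 9 / 512 * (ln 2) ^ 2
     - 3 / 128 * (atan (sqrt 7 / 5)) ^ 2
     - (1 / 224 - 89 / 6272 * ln 2) * sqrt 7 * atan (sqrt 7 / 5)).
Proof.
  apply is_series_summand, is_RInt_integrand.
Qed.
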